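(* Let $S$ be the set containing 2 copies of each odd positive integer that is not a multiple of 5 and 4 copies of each even positive integer that is not a multiple of 5; let $T$ be the set containing 2 copies of each even positive integer that is not a multiple of 5 and 4 copies of each odd positive integer that is not a multiple of 5. Let $D_S(N)$ (respectively, $D_T(N)$) be the number of partitions of $N$ into an odd number of distinct elements of $S$ (respectively, $T$). Then, for every integer $N\geq 2$, $$D_S(N)=D_T(N-1).$$
   Context: A ''set containing several copies'' of certain integers means a set of colored integers: the different copies of the same integer are regarded as distinct (distinguishable) elements, each having that integer as its value. A partition of $N$ into distinct elements of $X$ is a finite subset of $X$ whose elements have values summing to $N$ (so each copy is used at most once, but different copies of the same integer may be used together, and subsets using different copies are counted as different); the number of parts is the cardinality of this subset. *)

(* Defs.v *)
From mathcomp Require Import all_boot.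
From mathcomp Require Import finmap.

Set Implicit Arguments.
Unset Strict Implicit.
Unset Printing Implicit Defensive.

Local Open Scope nat_scope.
Local Open Scope fset_scope.

(* The pair (n, c) is the copy of the integer n with color c. *)
Definition colored := (nat * nat)%type.

Definition value (x : colored) : nat := x.1.
Definition color (x : colored) : nat := x.2.

(* mult n copies of each positive integer n, with colors 0, ..., mult n - 1. *)
Definition copies (mult : nat -> nat) : pred colored :=
  [pred x | (0 < value x) && (color x < mult (value x))].

Definition is_partition (X : pred colored) (N : nat) (P : {fset colored}) :
  bool := all X P && (\sum_(x <- P) value x == N).

Definition copies_upto (mult : nat -> nat) (N : nat) : {fset colored} :=
  [fset x in [seq (n, c) | n <- iota 1 N, c <- iota 0 (mult n)]].

(* Restricting to subsets of copies_upto loses nothing, since a part of a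
   partition of N is at most N: see in_partitions. *)
Definition partitions (mult : nat -> nat) (N : nat) : {fset {fset colored}} :=
  [fset P in fpowerset (copies_upto mult N) | is_partition (copies mult) N P].

Lemma in_copies_upto mult N x :
  (x \in copies_upto mult N) = copies mult x && (value x <= N).
Proof.
case: x => n c; rewrite /copies_upto inE /=; apply/allpairsPdep/idP.
  move=> [n' [c' [Hn Hc [-> ->]]]].
  move: Hn Hc; rewrite !mem_iota /copies /= /value /color /= add1n ltnS add0n.
  by move=> /andP[-> ->] ->.
rewrite /copies /= /value /color /= => /andP[/andP[n0 cm] nN].
by exists n, c; rewrite !mem_iota add1n ltnS n0 nN add0n cm.
Qed.

Lemma in_partitions mult N (P : {fset colored}) :
  (P \in partitions mult N) = is_partition (copies mult) N P.
Proof.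
rewrite !inE /= andb_idl // => /andP[/allP XP /eqP sumP].
rewrite fpowersetE; apply/fsubsetP => x xP.
rewrite in_copies_upto (XP _ xP) /= -sumP.
by rewrite (big_rem x) //= leq_addr.
Qed.

Definition odd_partition_number (mult : nat -> nat) (N : nat) : nat :=
  #|` [fset P in partitions mult N | odd #|` P|] |.

Definition multS (n : nat) : nat :=
  if 5 %| n then 0 else if odd n then 2 else 4.

Definition multT (n : nat) : nat :=
  if 5 %| n then 0 else if odd n then 4 else 2.

Definition D_S (N : nat) : nat := odd_partition_number multS N.
Definition D_T (N : nat) : nat := odd_partition_number multT N.

(* Main.v *)
Require Import Defs.
From mathcomp Require Import all_boot all_order all_algebra finmap.
From mathcomp Require Import classical_sets functions cardinality fsbigop.
From mathcomp Require Import qpoly zify ring.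

Set Implicit Arguments.
Unset Strict Implicit.
Unset Printing Implicit Defensive.

Import GRing.Theory.
Import Pdiv.Ring Pdiv.RingMonic.

(** Let G_S(c) be the product of (1 + c x^n) over all elements of S, n being the
    value of the element, and likewise for T.  Then (G_S(1) - G_S(-1))/2 generates
    the numbers D_S(N), and the theorem is read off in degrees N >= 2 from

      G_S(1) - G_S(-1) - x (G_T(1) - G_T(-1)) = 4x.

    Put s(x) = prod (1 - x^n) over odd n, e(x) = prod (1 - x^n) over even n, and
    sg = s(x)/s(x^5), ta = s(-x)/s(-x^5), eta = e(x)/e(x^5).  Since
    s(x) s(-x) prod_(n even) (1 + x^n) = 1, the four products are

      G_S(-1) = sg^2 eta^4,  G_S(1) = sg^-4 ta^-2,
      G_T(-1) = sg^4 eta^2,  G_T(1) = sg^-2 ta^2,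

    and the claim is a polynomial relation between modular functions of level 20.
    It follows from one relation of level 10,

      (eta^2/sg^2 - x) (1 - sg^4 eta^2) = 4x,

    and its image under x -> -x, which exchanges sg and ta ([quintic_algebra]).
    For Ramanujan's theta functions phi(x) = sum x^(j^2) and
    psi(x) = sum_(n >= 0) x^(n(n+1)/2), one has phi(-x) = s^2 e and psi(x) = e/s,
    so that relation is the product of the classical dissections

      psi(x)^2 - x psi(x^5)^2 = f(x, x^4) f(x^2, x^3),
      phi(x)^2 - phi(x^5)^2 = 4x f(x, x^9) f(x^3, x^7)

    (the second one at -x), whose right-hand sides are infinite products by the
    Jacobi triple product.  Both dissections come from splitting the lattice Z^2
    into the cosets of the sublattice of index 5 spanned by (2, 1) and (1, -2), on
    which the form m^2 + n^2 is 5 times itself ([zsum_lattice]).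

    All series live in a commutative ring with an element x such that x^M = 0: a
    theta series is then a finitely supported sum over the integers, an infinite
    product is a product over i < M, and a series with constant term 1 is a unit.
    The quotient Z['X]/('X^(N+1)) is such a ring, and it still sees the
    coefficient of degree N. *)

Section ThetaIdentities.
Local Open Scope ring_scope.

(** * Sums over the integers *)

Section IntegerSums.
Variable R : comNzRingType.
Implicit Types F G : int -> R.

(** The sum over all integers of a family with finite support.  The default
    value 0 for infinite supports never matters, but it lets reindexing lemmas
    such as [zsum_shift] hold without any side condition. *)
Definition zsum F : R := \sum_(n \in [set: int]) F n.

Definition vanishes_outside (B : nat) F := forall n : int, (B <= `|n|)%N -> F n = 0.

Lemma zsumE B F : vanishes_outside B F ->
  zsum F = \sum_(i < B.*2) F (i%:Z - B%:Z).
Proof.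
move=> F0; rewrite /zsum (@fsbigE _ _ _ _ _ [seq i%:Z - B%:Z | i <- iota 0 B.*2]).
- under eq_bigl do rewrite in_setT.
  by rewrite big_map -(big_mkord xpredT (fun i => F (i%:Z - B%:Z))) /index_iota subn0.
- by rewrite map_inj_uniq ?iota_uniq // => i j /addIr [].
- by [].
move=> /= n _ nB; apply: F0; rewrite leqNgt; apply: contra nB => nB.
apply/mapP; exists (absz (n + B%:Z)%R); last by lia.
by rewrite mem_iota; lia.
Qed.

Lemma eq_zsum F G : F =1 G -> zsum F = zsum G.
Proof. by move=> FG; apply: eq_fsbigr => n _. Qed.

Lemma zsum_shift c F : zsum F = zsum (fun n => F (n + c)).
Proof.
apply: (reindex_fsbigT (fun n : int => n + c)).
by exists (fun n => n - c) => n; [rewrite addrK | rewrite subrK].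
Qed.

Lemma zsumD B F G : vanishes_outside B F -> vanishes_outside B G ->
  zsum (fun n => F n + G n) = zsum F + zsum G.
Proof.
move=> F0 G0; rewrite (zsumE F0) (zsumE G0) -big_split.
by apply: zsumE => n Bn; rewrite F0 ?G0 ?addr0.
Qed.

Lemma zsum_sum B n (F : 'I_n -> int -> R) :
    (forall r, vanishes_outside B (F r)) ->
  zsum (fun k => \sum_(r < n) F r k) = \sum_(r < n) zsum (F r).
Proof.
move=> F0; rewrite (@zsumE B) => [|k Bk]; last first.
  by rewrite big1 // => r _; rewrite F0.
by rewrite exchange_big; apply: eq_bigr => r _; rewrite (zsumE (F0 r)).
Qed.

Lemma mulr_zsumr B (c : R) F : vanishes_outside B F ->
  c * zsum F = zsum (fun n => c * F n).
Proof.
move=> F0; rewrite (zsumE F0) mulr_sumr.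
by symmetry; apply: zsumE => n Bn; rewrite F0 ?mulr0.
Qed.

Lemma exchange_zsum B (F : int -> int -> R) :
    (forall m n, (B <= `|m|)%N || (B <= `|n|)%N -> F m n = 0) ->
  zsum (fun m => zsum (F m)) = zsum (fun n => zsum (F ^~ n)).
Proof.
move=> F0.
have FE m : zsum (F m) = \sum_(i < B.*2) F m (i%:Z - B%:Z).
  by apply: zsumE => n Bn; rewrite F0 ?Bn ?orbT.
have FE' n : zsum (F ^~ n) = \sum_(i < B.*2) F (i%:Z - B%:Z) n.
  by apply: zsumE => m Bm; rewrite F0 ?Bm.
rewrite (eq_zsum FE) (eq_zsum FE') (@zsumE B) ?(@zsumE B).
- by rewrite exchange_big.
- by move=> n Bn; rewrite big1 // => i _; rewrite F0 ?Bn ?orbT.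
by move=> n Bn; rewrite big1 // => i _; rewrite F0 ?Bn.
Qed.

Lemma big_ord_blocks (T : Type) (idx : T) (op : Monoid.law idx) d K
    (G : nat -> T) :
  \big[op/idx]_(i < d * K) G i =
    \big[op/idx]_(k < K) \big[op/idx]_(r < d) G (d * k + r)%N.
Proof.
elim: K => [|K IH]; first by rewrite muln0 !big_ord0.
by rewrite big_ord_recr -IH mulnS addnC big_split_ord.
Qed.

Lemma zsum_dissect (d : nat) B F : (0 < d)%N -> vanishes_outside B F ->
  zsum F = \sum_(r < d) zsum (fun n => F (d%:Z * n + r%:Z)).
Proof.
move=> d0 F0; rewrite (@zsumE (d * B.+1)); last first.
  by move=> n dn; apply: F0; apply: leq_trans dn; nia.
rewrite doubleMr (big_ord_blocks _ _ _ (fun i => F (i%:Z - (d * B.+1)%:Z))).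
rewrite exchange_big.
apply: eq_bigr => r _; symmetry; rewrite (@zsumE B.+1); last first.
  move=> n Bn; apply: F0; have := ltn_ord r; nia.
by apply: eq_bigr => k _; congr F; lia.
Qed.

(** The vectors (2k + l, k - 2l) form a sublattice of index 5, and the vectors
    (r, 0) with 0 <= r < 5 represent its cosets.  The map (k, l) -> (2k + l, k - 2l)
    multiplies m^2 + n^2 by 5, which is what turns the square of a theta series
    in x into theta series in x^5.  Only one-dimensional moves are needed: with
    m = 2n + t, the coset of (m, n) is given by t modulo 5. *)
Lemma zsum_lattice B (F : int -> int -> R) :
    (forall m n, (B <= `|m|)%N || (B <= `|n|)%N -> F m n = 0) ->
  zsum (fun m => zsum (F m)) =
  \sum_(r < 5) zsum (fun l => zsum (fun k => F (2 * k + l + r%:Z) (k - 2 * l))).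
Proof.
move=> F0; rewrite (exchange_zsum F0).
have F1 n : zsum (F ^~ n) = \sum_(r < 5) zsum (fun l => F (2 * n + (5 * l + r%:Z)) n).
  rewrite (@zsum_shift (2 * n)) (@zsum_dissect 5 (B + 2 * `|n|)) //.
    by apply: eq_bigr => r _; apply: eq_zsum => l; rewrite addrC.
  by move=> m Bm; apply: F0; apply/orP; left; lia.
rewrite (eq_zsum F1) /=.
have F2 (r : 'I_5) m n : (B.*2 + B + 5 <= `|m|)%N || (B.*2 + B + 5 <= `|n|)%N ->
    F (2 * m + (5 * n + r%:Z)) m = 0.
  move=> mn; apply: F0; have := ltn_ord r; lia.
rewrite (@zsum_sum (B.*2 + B + 5)) => [|r m Bm]; last first.
  by rewrite /zsum fsbig1 // => n _; rewrite F2 ?Bm.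
apply: eq_bigr => r _; rewrite (exchange_zsum (F2 r)).
apply: eq_zsum => l; rewrite (@zsum_shift (- (2 * l))).
by apply: eq_zsum => k; congr F; ring.
Qed.
End IntegerSums.

(** * Theta series and their dissections modulo 5 *)

(** The triangular number j(j+1)/2, which takes the same value at n and -(n+1). *)
Definition tri (j : int) : nat :=
  match j with Posz n | Negz n => 'C(n.+1, 2) end.

Lemma triE j : (tri j)%:Z * 2 = j * (j + 1).
Proof.
have binE n : (('C(n.+1, 2) * 2) = n.+1 * n)%N.
  by rewrite bin2 muln2 halfK /= oddM /= andNb subn0.
case: j => n; rewrite /tri.
  have := binE n; lia.
have := binE n; rewrite NegzE; lia.
Qed.

(** The exponent of Ramanujan's f(x^a, x^b), namely ((a+b) j^2 + (a-b) j)/2. *)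
Definition theta_exp (a b : nat) (j : int) : nat := (a * tri j + b * tri (- j))%N.

Lemma theta_expE a b j :
  (theta_exp a b j)%:Z * 2 = (a%:Z + b%:Z) * j ^+ 2 + (a%:Z - b%:Z) * j.
Proof.
rewrite /theta_exp PoszD !PoszM mulrDl -!mulrA !triE; ring.
Qed.

Lemma double_int_inj (m n : nat) : m%:Z * 2 = n%:Z * 2 -> m = n.
Proof. lia. Qed.

(** Equality of natural exponents is decided on doubled integer quadratic forms,
    where it becomes a polynomial identity. *)
Lemma theta_expD_eq a b i j c a1 b1 k a2 b2 l :
    (a%:Z + b%:Z) * (i ^+ 2 + j ^+ 2) + (a%:Z - b%:Z) * (i + j) =
    c%:Z * 2 + ((a1%:Z + b1%:Z) * k ^+ 2 + (a1%:Z - b1%:Z) * k) +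
      ((a2%:Z + b2%:Z) * l ^+ 2 + (a2%:Z - b2%:Z) * l) ->
  (theta_exp a b i + theta_exp a b j = c + theta_exp a1 b1 k + theta_exp a2 b2 l)%N.
Proof.
rewrite -!theta_expE !mulrDr addrACA -!theta_expE.
move: (theta_exp _ _ _) (theta_exp _ _ _) (theta_exp _ _ _) (theta_exp _ _ _); lia.
Qed.

Lemma leq_absz_theta_exp a b j : (0 < a)%N -> (0 < b)%N -> (`|j| <= theta_exp a b j)%N.
Proof.
move=> a0 b0; have /= := triE j; have /= := triE (- j).
have : (tri j + tri (- j) <= theta_exp a b j)%N by rewrite leq_add // leq_pmull.
move: (theta_exp _ _ _) (tri j) (tri _) => e t t'; nia.
Qed.

Section Nilpotent.
Variables (R : comNzRingType) (M : nat).

Lemma exprM0 (x : R) k : x ^+ M = 0 -> (M <= k)%N -> x ^+ k = 0.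
Proof. by move=> xM0 Mk; rewrite -(subnKC Mk) exprD xM0 mul0r. Qed.

(** Ramanujan's f(x^a, x^b).  In particular [theta x 1 1] is phi(x) = sum x^(j^2)
    and [theta x 1 3] is psi(x), the sum of x^(n(n+1)/2) over n >= 0. *)
Definition theta (x : R) a b : R := zsum (fun j => x ^+ theta_exp a b j).

Variables (x : R) (xM0 : x ^+ M = 0).

Lemma theta_vanishes a b : (0 < a)%N -> (0 < b)%N ->
  vanishes_outside M (fun j => x ^+ theta_exp a b j).
Proof.
by move=> a0 b0 j Mj; rewrite (exprM0 xM0) // (leq_trans Mj) ?leq_absz_theta_exp.
Qed.

(** A double series whose exponent separates after a translation by (k0, l0)
    factors into two theta series.  This recognizes each coset in the dissections
    below; the translations complete the squares there. *)
Lemma theta_mul a b a' b' c k0 l0 (h : int -> int -> nat) :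
    (0 < a)%N -> (0 < b)%N -> (0 < a')%N -> (0 < b')%N ->
    (forall k l, h (k + k0) (l + l0) = (c + theta_exp a b k + theta_exp a' b' l)%N) ->
  zsum (fun l => zsum (fun k => x ^+ h k l)) =
    x ^+ c * theta x a b * theta x a' b'.
Proof.
move=> a0 b0 a'0 b'0 hE; rewrite (@zsum_shift _ l0).
have inner l : zsum (fun k => x ^+ h k (l + l0)) =
    x ^+ c * theta x a b * x ^+ theta_exp a' b' l.
  rewrite (@zsum_shift _ k0) [RHS]mulrAC (mulr_zsumr _ (theta_vanishes a0 b0)).
  by apply: eq_zsum => k; rewrite hE !exprD mulrAC.
by rewrite (eq_zsum inner) (mulr_zsumr _ (theta_vanishes a'0 b'0)).
Qed.

Lemma theta_square_lattice a b : (0 < a)%N -> (0 < b)%N ->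
  theta x a b ^+ 2 = \sum_(r < 5) zsum (fun l => zsum (fun k =>
    x ^+ (theta_exp a b (2 * k + l + r%:Z) + theta_exp a b (k - 2 * l)))).
Proof.
move=> a0 b0.
rewrite -(@zsum_lattice _ M
  (fun m n => x ^+ (theta_exp a b m + theta_exp a b n))).
  rewrite expr2 {2}/theta (mulr_zsumr _ (theta_vanishes a0 b0)).
  apply: eq_zsum => m; rewrite mulrC (mulr_zsumr _ (theta_vanishes a0 b0)).
  by apply: eq_zsum => n; rewrite exprD.
move=> m n Mmn; apply: (exprM0 xM0).
have := leq_absz_theta_exp m a0 b0; have := leq_absz_theta_exp n a0 b0; lia.
Qed.

Lemma thetaX d a b : theta (x ^+ d) a b = theta x (d * a) (d * b).
Proof. by apply: eq_zsum => j; rewrite -exprM /theta_exp mulnDr !mulnA. Qed.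

Lemma thetaC a b : theta x a b = theta x b a.
Proof.
rewrite /theta /zsum (reindex_fsbigT (fun j : int => - j)).
  by apply: eq_zsum => j; rewrite /theta_exp opprK addnC.
by exists (fun j => - j) => j; rewrite opprK.
Qed.

Ltac theta_ring := move=> k l; apply: theta_expD_eq; ring.

(** In phi(x)^2 the trivial coset of the sublattice gives phi(x^5)^2 and, by the
    symmetries of the form m^2 + n^2, the four others give equal contributions,
    x f(x, x^9) f(x^3, x^7) each. *)
Lemma theta11_dissection :
  theta x 1 1 ^+ 2 - theta (x ^+ 5) 1 1 ^+ 2 = 4%:R * x * theta x 1 9 * theta x 3 7.
Proof.
rewrite theta_square_lattice // !big_ord_recr big_ord0 /= add0r thetaX.
rewrite (@theta_mul 5 5 5 5 0 0 0) //; last by theta_ring.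
rewrite (@theta_mul 9 1 7 3 1 0 0) //; last by theta_ring.
rewrite (@theta_mul 3 7 9 1 1 (-1) 0) //; last by theta_ring.
rewrite (@theta_mul 7 3 1 9 1 (-1) (-1)) //; last by theta_ring.
rewrite (@theta_mul 1 9 3 7 1 (-2) (-1)) //; last by theta_ring.
rewrite (thetaC 9) (thetaC 7).
ring.
Qed.

(** The sum is split by the parity of the index; 2n and 2n+1 give again exponents
    of theta series, the second one up to the constant a. *)
Lemma theta_even_odd a b : (0 < a)%N -> (a < b)%N ->
  theta x a b =
    theta x (3 * a + b) (a + 3 * b) + x ^+ a * theta x (5 * a + 3 * b) (b - a).
Proof.
move=> a0 ab; have b0 : (0 < b)%N by apply: leq_trans ab.
rewrite {1}/theta (zsum_dissect (isT : 0 < 2)%N (theta_vanishes a0 b0)).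
rewrite !big_ord_recr big_ord0 /= add0r; congr (_ + _).
  apply: eq_zsum => n; congr (_ ^+ _).
  by apply: double_int_inj; rewrite !theta_expE !PoszD ?PoszM; ring.
rewrite (mulr_zsumr _ (theta_vanishes _ _)) ?subn_gt0 //; last first.
  by rewrite addn_gt0 !muln_gt0 a0.
apply: eq_zsum => n; rewrite -exprD; congr (_ ^+ _).
apply: double_int_inj; rewrite [in RHS]PoszD mulrDl !theta_expE -(subzn (ltnW ab)).
by rewrite !PoszD ?PoszM; ring.
Qed.

(** In psi(x)^2 the coset r = 1 gives x psi(x^5)^2, and the other four are the
    products of an even or odd half of f(x, x^4) with an even or odd half of
    f(x^2, x^3). *)
Lemma theta13_dissection :
  theta x 1 3 ^+ 2 - x * theta (x ^+ 5) 1 3 ^+ 2 = theta x 1 4 * theta x 2 3.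
Proof.
rewrite theta_square_lattice // !big_ord_recr big_ord0 /= add0r thetaX.
rewrite (@theta_mul 7 13 11 9 0 0 0) //; last by theta_ring.
rewrite (@theta_mul 15 5 15 5 1 0 0) //; last by theta_ring.
rewrite (@theta_mul 3 17 19 1 3 (-1) 0) //; last by theta_ring.
rewrite (@theta_mul 11 9 3 17 1 (-1) (-1)) //; last by theta_ring.
rewrite (@theta_mul 19 1 7 13 2 (-1) (-1)) //; last by theta_ring.
rewrite (@theta_even_odd 1 4) // (@theta_even_odd 2 3) //=.
rewrite (thetaC 3 17) (thetaC 11 9) (thetaC 15 5).
ring.
Qed.

End Nilpotent.

(** * Products in a ring where x is nilpotent *)

Section Products.
Variables (R : comNzRingType) (M : nat).
Implicit Types (x y : R) (F : nat -> R).

(** When x^M = 0 the factors 1 + c x^i with i >= M are trivial, so products over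
    i < M stand for infinite products: the cut-off may be moved freely, and the
    factors regrouped by residue classes. *)
Lemma prod_widen F K : (forall i, (M <= i)%N -> F i = 1) -> (M <= K)%N ->
  \prod_(i < K) F i = \prod_(i < M) F i.
Proof.
move=> F1 MK; rewrite -(subnKC MK) big_split_ord /= [X in _ * X]big1 ?mulr1 //.
by move=> i _; rewrite F1 // leq_addr.
Qed.

Lemma prod_dissect d F : (0 < d)%N -> (forall i, (M <= i)%N -> F i = 1) ->
  \prod_(i < M) F i = \prod_(r < d) \prod_(i < M) F (d * i + r)%N.
Proof.
move=> d0 F1; rewrite -(@prod_widen F (d * M)) ?leq_pmull //.
by rewrite big_ord_blocks exchange_big.
Qed.

(** The elements with constant term 1.  They are invertible when x is nilpotent,
    which replaces every division below. *)
Definition one_mod x u := exists t, u = 1 + x * t.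

Lemma one_mod1 x : one_mod x 1.
Proof. by exists 0; rewrite mulr0 addr0. Qed.

Lemma one_modM x u v : one_mod x u -> one_mod x v -> one_mod x (u * v).
Proof. by move=> [s ->] [t ->]; exists (s + t + x * s * t); ring. Qed.

Lemma one_mod_prod x n F :
  (forall i, (i < n)%N -> one_mod x (F i)) -> one_mod x (\prod_(i < n) F i).
Proof.
move=> F1; apply: big_ind => [||i _]; [exact: one_mod1|exact: one_modM|exact: F1].
Qed.

Lemma one_mod_inv x u : x ^+ M = 0 -> one_mod x u ->
  exists2 v, one_mod x v & u * v = 1.
Proof.
move=> xM0 [t ->].
have : (1 + x * t) * \sum_(i < M) (- (x * t)) ^+ i = 1.
  have := subrX1 (- (x * t)) M; rewrite exprNn exprMn xM0 mul0r mulr0 => e.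
  apply: oppr_inj; rewrite -mulNr opprD addrC -e; ring.
move: (\sum_(i < M) _) => v uv; exists v => //.
by exists (- t * v); rewrite -uv; ring.
Qed.

Definition odd_euler y : R := \prod_(i < M) (1 - y ^+ (2 * i).+1).

Definition euler_prod k y : R := \prod_(i < k) (1 - y ^+ i.+1).

(** The Gaussian binomial coefficient (2n choose n+j) in the variable y, centred so
    that the recurrence, two steps of Pascal's rule, is symmetric in j. *)
Fixpoint gauss y n (j : int) : R :=
  if n is n'.+1 then
    (1 + y ^+ (2 * n').+1) * gauss y n' j +
    y ^+ `|n%:Z - j| * gauss y n' (j - 1) + y ^+ `|n%:Z + j| * gauss y n' (j + 1)
  else (j == 0)%:R.

Lemma gauss_out y n j : (n < `|j|)%N -> gauss y n j = 0.
Proof.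
elim: n j => [|n IH] j nj /=; first by case: eqP nj => // ->.
by rewrite !IH; [ring|lia..].
Qed.

(** The closed form (y)_{2n} / ((y)_{n-j} (y)_{n+j}) with j = n - p, freed of
    denominators.  Each term of the recurrence, multiplied by (y)_p (y)_q, is a
    multiple of (y)_{2n} also at the boundary of the support, because
    1 - y^0 = 0 kills the terms that are out of range. *)
Lemma gaussE y n p q : (p + q = 2 * n)%N ->
  gauss y n (n%:Z - p%:Z) * euler_prod p y * euler_prod q y = euler_prod (2 * n) y.
Proof.
elim: n p q => [|n IH] p q pq.
  have [-> ->] : p = 0%N /\ q = 0%N by lia.
  by rewrite /= /euler_prod !big_ord0 !mulr1.
have eulerS k : euler_prod k.+1 y = euler_prod k y * (1 - y ^+ k.+1).
  by rewrite /euler_prod big_ord_recr.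
set j : int := _ - _.
have mid : gauss y n j * euler_prod p y * euler_prod q y =
    (1 - y ^+ p) * (1 - y ^+ q) * euler_prod (2 * n) y.
  case: p q pq @j => [|p] [|q] pq j; try by rewrite gauss_out ?expr0 ?subrr; [ring|lia].
  have pq' : (p + q = 2 * n)%N by lia.
  rewrite -(IH p q pq') !eulerS (_ : n%:Z - p%:Z = j); last by lia.
  ring.
have low : gauss y n (j - 1) * euler_prod p y * euler_prod q y * y ^+ p =
    (y ^+ p - y ^+ (2 * n).+1) * (1 - y ^+ q) * euler_prod (2 * n) y.
  case: q pq mid => [|[|q]] pq _.
  - by rewrite gauss_out ?expr0 ?subrr; [ring|lia].
  - have pE : p = (2 * n).+1 by lia.
    by rewrite gauss_out ?pE ?subrr ?mul0r //; lia.
  have pq' : (p + q = 2 * n)%N by lia.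
  have -> : y ^+ (2 * n).+1 = y ^+ p * y ^+ q.+1 by rewrite -exprD -pq' addnS.
  rewrite -(IH p q pq') !eulerS (_ : n%:Z - p%:Z = j - 1); last by lia.
  ring.
have high : gauss y n (j + 1) * euler_prod p y * euler_prod q y * y ^+ q =
    (y ^+ q - y ^+ (2 * n).+1) * (1 - y ^+ p) * euler_prod (2 * n) y.
  case: p pq @j mid low => [|[|p]] pq j _ _.
  - by rewrite gauss_out ?expr0 ?subrr; [ring|lia].
  - have qE : q = (2 * n).+1 by lia.
    by rewrite gauss_out ?qE ?subrr ?mul0r //; lia.
  have pq' : (p + q = 2 * n)%N by lia.
  have -> : y ^+ (2 * n).+1 = y ^+ p.+1 * y ^+ q by rewrite -exprD -pq' addSn.
  rewrite -(IH p q pq') !eulerS (_ : n%:Z - p%:Z = j + 1); last by lia.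
  ring.
have -> : (2 * n.+1 = (2 * n).+2)%N by lia.
rewrite !eulerS /=.
have -> : (absz (n.+1%:Z - j)%R = p)%N by lia.
have -> : (absz (n.+1%:Z + j)%R = q)%N by lia.
transitivity (
  (1 + y ^+ (2 * n).+1) * (gauss y n j * euler_prod p y * euler_prod q y) +
  gauss y n (j - 1) * euler_prod p y * euler_prod q y * y ^+ p +
  gauss y n (j + 1) * euler_prod p y * euler_prod q y * y ^+ q).
  ring.
rewrite mid low high.
have yy : y ^+ p * y ^+ q = y ^+ (2 * n).+2 by rewrite -exprD; congr (_ ^+ _); lia.
rewrite -yy; ring.
Qed.

End Products.

(** * The Jacobi triple product *)

Lemma theta_exp_pred a b j :
  (theta_exp a b j)%:Z = (theta_exp a b (j - 1))%:Z + (a%:Z + b%:Z) * j - b%:Z.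
Proof.
have double_inj (u v : int) : u * 2 = v * 2 -> u = v by lia.
by apply: double_inj; rewrite !mulrDl !theta_expE; ring.
Qed.

Section JTP.
Variables (R : comNzRingType) (M : nat).
Implicit Types (x y : R) (F : nat -> R).

(** The finite form of the triple product, by induction on n: the two new factors
    multiply out to 1 + y^(2n+1) plus two monomials, and those two shift j
    by one in either direction, as in the recurrence of [gauss]. *)
Lemma finite_triple_product x a b n : (0 < a)%N -> (0 < b)%N -> x ^+ M = 0 ->
  \prod_(i < n) ((1 + x ^+ (a + (a + b) * i)) * (1 + x ^+ (b + (a + b) * i))) =
  zsum (fun j => gauss (x ^+ (a + b)) n j * x ^+ theta_exp a b j).
Proof.
move=> a0 b0 xM0; set y := x ^+ (a + b).
have y_exp k : y ^+ k = x ^+ ((a + b) * k) by rewrite -exprM.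
elim: n => [|n IH].
  rewrite big_ord0 (@zsumE _ 1) => [|j j1] /=; last first.
    by case: eqP j1 => [->//|_ _]; rewrite mul0r.
  rewrite !big_ord_recr big_ord0 /= mul0r !add0r subrr mul1r.
  by rewrite /theta_exp !muln0 expr0.
rewrite big_ord_recr IH /=.
pose G j := gauss y n j * x ^+ theta_exp a b j.
have G0 j : (n < `|j|)%N -> G j = 0 by move=> nj; rewrite /G gauss_out ?mul0r.
have down j : y ^+ `|n.+1%:Z - j| * gauss y n (j - 1) * x ^+ theta_exp a b j =
    x ^+ (a + (a + b) * n) * G (j - 1).
  rewrite /G; case: (ltnP n `|j - 1|) => [nj|jn].
    by rewrite gauss_out // !(mulr0, mul0r).
  rewrite mulrAC y_exp -exprD [RHS]mulrCA -exprD mulrC; congr (_ * _ ^+ _).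
  have [k kE] : exists k : nat, j = n.+1%:Z - k%:Z by exists (absz (n.+1%:Z - j)%R); lia.
  have := theta_exp_pred a b j.
  move: (theta_exp _ _ _) (theta_exp _ _ _) => e e'; rewrite kE; lia.
have up j : y ^+ `|n.+1%:Z + j| * gauss y n (j + 1) * x ^+ theta_exp a b j =
    x ^+ (b + (a + b) * n) * G (j + 1).
  rewrite /G; case: (ltnP n `|j + 1|) => [nj|jn].
    by rewrite gauss_out // !(mulr0, mul0r).
  rewrite mulrAC y_exp -exprD [RHS]mulrCA -exprD mulrC; congr (_ * _ ^+ _).
  have [k kE] : exists k : nat, j = k%:Z - n.+1%:Z by exists (absz (n.+1%:Z + j)%R); lia.
  have := theta_exp_pred a b (j + 1); rewrite addrK.
  move: (theta_exp _ _ _) (theta_exp _ _ _) => e e'; rewrite kE; lia.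
have split3 j : gauss y n.+1 j * x ^+ theta_exp a b j =
    (1 + y ^+ (2 * n).+1) * G j +
    (x ^+ (a + (a + b) * n) * G (j - 1) + x ^+ (b + (a + b) * n) * G (j + 1)).
  by rewrite -down -up /= /G; ring.
rewrite (eq_zsum split3).
rewrite !(@zsumD _ n.+2); try by move=> j jn; rewrite ?G0 ?mulr0 ?addr0 //; lia.
rewrite -!(@mulr_zsumr _ n.+2); try by move=> j jn; rewrite ?G0 //; lia.
rewrite -!zsum_shift -mulrDl -mulrDl mulrC; congr (_ * _).
have -> : y ^+ (2 * n).+1 = x ^+ (a + (a + b) * n) * x ^+ (b + (a + b) * n).
  by rewrite y_exp -exprD; congr (_ ^+ _); lia.
by ring.
Qed.

End JTP.

(** * Product formulas *)

Section Prods.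
Variables (R : comNzRingType) (M : nat).
Implicit Types (x y : R) (F : nat -> R).
Local Notation euler := (euler_prod M).
Local Notation odd_euler := (odd_euler M).

Lemma exprM0X x k : (0 < k)%N -> x ^+ M = 0 -> (x ^+ k) ^+ M = 0.
Proof. by move=> k0 xM0; rewrite -exprM (exprM0 xM0) // leq_pmull. Qed.

Lemma exprM0N x : x ^+ M = 0 -> (- x) ^+ M = 0.
Proof. by move=> xM0; rewrite exprNn xM0 mulr0. Qed.

Lemma one_mod_sum1X x (c : R) k : (0 < k)%N -> one_mod x (1 + c * x ^+ k).
Proof. by case: k => // k _; exists (c * x ^+ k); rewrite exprS; ring. Qed.

Lemma one_mod_euler x k : (0 < k)%N -> one_mod x (euler (x ^+ k)).
Proof.
move=> k0; apply: one_mod_prod (fun i => 1 - (x ^+ k) ^+ i.+1) _ => i _.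
by rewrite -exprM -mulN1r; apply: one_mod_sum1X; rewrite muln_gt0 k0.
Qed.

Lemma one_mod_odd_euler x k : (0 < k)%N -> one_mod x (odd_euler (x ^+ k)).
Proof.
move=> k0; apply: one_mod_prod (fun i => 1 - (x ^+ k) ^+ (2 * i).+1) _ => i _.
by rewrite -exprM -mulN1r; apply: one_mod_sum1X; rewrite muln_gt0 k0.
Qed.

Lemma one_mod_cancel x u v w : x ^+ M = 0 -> one_mod x u ->
  u * v = u * w -> v = w.
Proof.
move=> xM0 /(one_mod_inv xM0) [u' _ uu'] /(congr1 ( *%R u')).
by rewrite !mulrA (mulrC u') uu' !mul1r.
Qed.

(** Once n is large, the central coefficients in [finite_triple_product] are the
    inverse of the Euler product, and the other terms vanish with x^M. *)
Lemma triple_product x a b : (0 < a)%N -> (0 < b)%N -> x ^+ M = 0 ->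
  theta x a b = (\prod_(i < M) (1 + x ^+ (a + (a + b) * i))) *
    (\prod_(i < M) (1 + x ^+ (b + (a + b) * i))) * euler (x ^+ (a + b)).
Proof.
move=> a0 b0 xM0; set y := x ^+ (a + b).
have m0 : (0 < a + b)%N by rewrite addn_gt0 a0.
have yM0 : y ^+ M = 0 by apply: exprM0X.
have trivial c i : (M <= i)%N -> 1 + x ^+ (c + (a + b) * i) = 1.
  by move=> Mi; rewrite (exprM0 xM0) ?addr0 //; nia.
have euler_prodE k : (M <= k)%N -> euler_prod k y = euler y.
  move=> Mk; apply: (@prod_widen _ M (fun i => 1 - y ^+ i.+1)) => // i Mi.
  by rewrite (exprM0 yM0) ?subr0 // leqW.
rewrite -big_split.
rewrite -(@prod_widen _ M (fun i => (1 + x ^+ (a + (a + b) * i)) *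
  (1 + x ^+ (b + (a + b) * i))) M.*2) //; last 2 first.
- by move=> i Mi; rewrite !trivial ?mulr1.
- by rewrite -addnn leq_addr.
rewrite (finite_triple_product _ a0 b0 xM0) -/y mulrC.
rewrite (@mulr_zsumr _ M); last first.
  move=> j Mj; rewrite (exprM0 xM0) ?mulr0 //.
  by apply: leq_trans Mj _; apply: leq_absz_theta_exp.
apply: eq_zsum => j; case: (leqP M `|j|) => [Mj|jM].
  by rewrite (exprM0 xM0) ?mulr0 // (leq_trans Mj) ?leq_absz_theta_exp.
(* The nonzero terms have `|j| < M, so both indices M.*2 - j and M.*2 + j exceed
   M and all three products in gaussE are the full Euler product. *)
suff inv : euler y * gauss y M.*2 j = 1 by rewrite mulrA inv mul1r.
pose p := absz (M.*2%:Z - j); pose q := absz (M.*2%:Z + j)%R.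
have pq : (p + q = 2 * M.*2)%N by rewrite /p /q; lia.
have := gaussE y pq; have -> : M.*2%:Z - p%:Z = j by rewrite /p; lia.
rewrite !euler_prodE; [|rewrite /p; lia|rewrite /q; lia|lia].
have yu : one_mod y (euler y) by have := @one_mod_euler y 1 isT; rewrite expr1.
move=> e; apply: (one_mod_cancel yM0 yu); rewrite mulr1 -[RHS]e; ring.
Qed.

Lemma euler_odd y : y ^+ M = 0 -> euler y = odd_euler y * euler (y ^+ 2).
Proof.
move=> yM0.
rewrite /euler_prod (@prod_dissect _ M 2 (fun i => 1 - y ^+ i.+1)) //; last first.
  by move=> i Mi; rewrite (exprM0 yM0) ?subr0 // leqW.
rewrite !big_ord_recr big_ord0 /= mul1r; congr (_ * _).
  by apply: eq_bigr => i _; rewrite addn0.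
by apply: eq_bigr => i _; rewrite addn1 -exprM mulnS.
Qed.

Lemma odd_eulerN y : odd_euler (- y) = \prod_(i < M) (1 + y ^+ (2 * i).+1).
Proof.
apply: eq_bigr => i _; rewrite exprNn -signr_odd /= oddM /= expr1 mulN1r.
by rewrite opprK.
Qed.

Lemma odd_eulerMN y : odd_euler y * odd_euler (- y) = odd_euler (y ^+ 2).
Proof.
rewrite odd_eulerN -big_split; apply: eq_bigr => i _ /=.
by rewrite -subr_sqr expr1n -!exprM mulnC.
Qed.

(** Partitions into distinct parts and into odd parts. *)
Lemma euler_identity y : y ^+ M = 0 ->
  (\prod_(i < M) (1 + y ^+ i.+1)) * odd_euler y = 1.
Proof.
move=> yM0; have yu := @one_mod_euler y 2 isT.
apply: (one_mod_cancel yM0 yu); rewrite mulr1 mulrC -mulrA -euler_odd //.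
rewrite -big_split; apply: eq_bigr => i _ /=.
by rewrite mulrC -subr_sqr expr1n -!exprM mulnC.
Qed.

Lemma theta11E x : x ^+ M = 0 -> theta x 1 1 = odd_euler (- x) ^+ 2 * euler (x ^+ 2).
Proof.
move=> xM0; rewrite triple_product // odd_eulerN expr2.
by congr (_ * _ * _).
Qed.

Lemma theta13E x : x ^+ M = 0 -> theta x 1 3 * odd_euler x = euler (x ^+ 2).
Proof.
move=> xM0; rewrite triple_product // [RHS]euler_odd ?exprM0X //.
rewrite -odd_eulerMN -exprM [LHS]mulrC mulrA; congr (_ * _ * _).
rewrite odd_eulerN (@prod_dissect _ M 2 (fun i => 1 + x ^+ (2 * i).+1)) //; last first.
  by move=> i Mi; rewrite (exprM0 xM0) ?addr0 //; lia.
rewrite !big_ord_recr big_ord0 /= mul1r; congr (_ * _);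
  by apply: eq_bigr => i _; congr (1 + x ^+ _); lia.
Qed.

(** The exponents 1, 4, 2, 3 modulo 5 of the triple products are all those prime
    to 5, so that f(x, x^4) f(x^2, x^3) is the square of the Euler product of x^5
    times the product of the 1 + x^n with n prime to 5. *)
Lemma theta_product_mod5 x : x ^+ M = 0 ->
  theta x 1 4 * theta x 2 3 * odd_euler x =
    euler (x ^+ 5) ^+ 2 * odd_euler (x ^+ 5).
Proof.
move=> xM0; have xM5 : (x ^+ 5) ^+ M = 0 by apply: exprM0X.
rewrite !triple_product //.
have := euler_identity xM0.
rewrite (@prod_dissect _ M 5 (fun i => 1 + x ^+ i.+1)) //; last first.
  by move=> i Mi; rewrite (exprM0 xM0) ?addr0 //; lia.
rewrite !big_ord_recr big_ord0 /= mul1r.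
have E r : \prod_(i < M) (1 + x ^+ (5 * i + r).+1) =
           \prod_(i < M) (1 + x ^+ (r.+1 + 5 * i)).
  by apply: eq_bigr => i _; rewrite addnC addSn.
rewrite !E.
have -> : \prod_(i < M) (1 + x ^+ (5 + 5 * i)) =
          \prod_(i < M) (1 + (x ^+ 5) ^+ i.+1).
  by apply: eq_bigr => i _; rewrite -exprM mulnS.
have := euler_identity xM5.
move: (\prod_(i < M) _) => w; move: (odd_euler (x ^+ 5)) => s5.
move: (\prod_(i < M) _) => w1; move: (\prod_(i < M) _) => w2.
move: (\prod_(i < M) _) => w3; move: (\prod_(i < M) _) => w4.
move=> ws5 w15.
transitivity ((w1 * w2 * w3 * w4 * w * odd_euler x) * (euler (x ^+ 5) ^+ 2 * s5)).
  by rewrite -[LHS]mulr1 -ws5; ring.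
by rewrite w15 mul1r.
Qed.

(** Likewise 1, 9, 3, 7 are the odd residues modulo 10 that are prime to 5. *)
Lemma theta_product_mod10 x : x ^+ M = 0 ->
  theta x 1 9 * theta x 3 7 * odd_euler (- x ^+ 5) =
    euler (x ^+ 10) ^+ 2 * odd_euler (- x).
Proof.
move=> xM0; rewrite !triple_product // !odd_eulerN.
rewrite (@prod_dissect _ M 5 (fun i => 1 + x ^+ (2 * i).+1)) //; last first.
  by move=> i Mi; rewrite (exprM0 xM0) ?addr0 //; lia.
rewrite !big_ord_recr big_ord0 /= mul1r.
have E r : \prod_(i < M) (1 + x ^+ (2 * (5 * i + r)).+1) =
           \prod_(i < M) (1 + x ^+ ((2 * r).+1 + 10 * i)).
  by apply: eq_bigr => i _; congr (1 + x ^+ _); lia.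
rewrite !E.
have -> : \prod_(i < M) (1 + (x ^+ 5) ^+ (2 * i).+1) =
          \prod_(i < M) (1 + x ^+ ((2 * 2).+1 + 10 * i)).
  by apply: eq_bigr => i _; rewrite -exprM; congr (1 + x ^+ _); lia.
by ring.
Qed.

End Prods.

(** * The identity between generating functions *)

Section Quintic.
Variables (R : comNzRingType) (M : nat).
Implicit Types (x y : R) (F : nat -> R).
Local Notation euler := (euler_prod M).
Local Notation odd_euler := (odd_euler M).

(** The product of the two dissections is
    (psi(x)^2 - x psi(x^5)^2) (phi(-x^5)^2 - phi(-x)^2) = 4x psi(x^5)^2 phi(-x^5)^2,
    because in the product of the right-hand sides of the dissections the factors
    with exponents prime to 5 cancel by Euler's identity.  Substituting phi(-x) = s^2 e and
    psi(x) = e / s and clearing denominators gives the form below. *)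
Lemma quintic_relation x : x ^+ M = 0 ->
  let s := odd_euler x in let s5 := odd_euler (x ^+ 5) in
  let e := euler (x ^+ 2) in let e5 := euler (x ^+ 10) in
  (e ^+ 2 * s5 ^+ 2 - x * e5 ^+ 2 * s ^+ 2) *
    (s5 ^+ 4 * e5 ^+ 2 - s ^+ 4 * e ^+ 2) =
  4%:R * x * s ^+ 2 * s5 ^+ 4 * e5 ^+ 4.
Proof.
move=> xM0 s s5 e e5.
have x5M0 : (x ^+ 5) ^+ M = 0 by apply: exprM0X.
have nxM0 := exprM0N xM0.
have x10 : (x ^+ 5) ^+ 2 = x ^+ 10 by rewrite -exprM.
have nx5 : (- x) ^+ 5 = - x ^+ 5 by rewrite exprNn; ring.
have nx10 : (- x) ^+ 10 = x ^+ 10 by rewrite exprNn; ring.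
have psi := theta13E xM0; have psi5 := theta13E x5M0.
have ph := theta11E nxM0; have ph5 := theta11E (exprM0N x5M0).
have I1 := theta13_dissection xM0; have I2 := theta11_dissection nxM0.
have f1 := theta_product_mod5 xM0; have f2 := theta_product_mod10 nxM0.
rewrite opprK sqrrN -/s -/e in ph.
rewrite opprK sqrrN x10 -/s5 -/e5 in ph5.
rewrite nx5 ph ph5 in I2.
rewrite nx5 !opprK nx10 -/s5 -/s -/e5 in f2.
rewrite -/s -/e in psi; rewrite x10 -/s5 -/e5 in psi5.
rewrite (euler_odd x5M0) x10 -/s -/s5 -/e5 in f1.
have s5u : one_mod x s5 by apply: one_mod_odd_euler.
have J1 : e ^+ 2 * s5 ^+ 2 - x * e5 ^+ 2 * s ^+ 2 = s5 ^+ 5 * e5 ^+ 2 * s.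
  transitivity ((theta x 1 3 ^+ 2 - x * theta (x ^+ 5) 1 3 ^+ 2) * s ^+ 2 * s5 ^+ 2).
    by rewrite -psi -psi5; ring.
  rewrite I1; transitivity ((theta x 1 4 * theta x 2 3 * s) * s * s5 ^+ 2); first by ring.
  by rewrite f1; ring.
have J2 : s5 * (s5 ^+ 4 * e5 ^+ 2 - s ^+ 4 * e ^+ 2) = 4%:R * x * e5 ^+ 2 * s.
  transitivity (- s5 * ((s ^+ 2 * e) ^+ 2 - (s5 ^+ 2 * e5) ^+ 2)); first by ring.
  rewrite I2.
  transitivity (4%:R * x * (theta (- x) 1 9 * theta (- x) 3 7 * s5)); first by ring.
  by rewrite f2; ring.
apply: (one_mod_cancel xM0 s5u); rewrite mulrCA J2 J1; ring.
Qed.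

(** For c = 1 this generates the partitions into distinct elements of the set
    with m n copies of n; for c = -1 they are counted with the parity of their
    number of parts as a sign. *)
Definition partition_gf (m : nat -> nat) x (c : R) : R :=
  \prod_(i < M) (1 + c * x ^+ i.+1) ^+ m i.+1.

Definition odd_partition_gf m x := partition_gf m x 1 - partition_gf m x (-1).

Definition parity_mult (p q n : nat) := if odd n then p else q.
Definition parity_mult5 (p q n : nat) := if (5 %| n)%N then 0%N else parity_mult p q n.

Lemma partition_gf_parity x c p q : x ^+ M = 0 ->
  partition_gf (parity_mult p q) x c =
    (\prod_(i < M) (1 + c * x ^+ (2 * i).+1)) ^+ p *
    (\prod_(i < M) (1 + c * (x ^+ 2) ^+ i.+1)) ^+ q.
Proof.
move=> xM0; rewrite /partition_gf.
rewrite (@prod_dissect _ M 2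
  (fun i => (1 + c * x ^+ i.+1) ^+ parity_mult p q i.+1)) //; last first.
  by move=> i Mi; rewrite (exprM0 xM0) ?mulr0 ?addr0 ?expr1n // leqW.
rewrite !big_ord_recr big_ord0 /= mul1r -!prodrXl; congr (_ * _).
  by apply: eq_bigr => i _; rewrite addn0 /parity_mult /= oddM.
by apply: eq_bigr => i _; rewrite addn1 /parity_mult /= oddM -exprM mulnS.
Qed.

Lemma partition_gf_parity5 x c p q : x ^+ M = 0 ->
  partition_gf (parity_mult5 p q) x c *
    partition_gf (parity_mult p q) (x ^+ 5) c =
  partition_gf (parity_mult p q) x c.
Proof.
move=> xM0; rewrite /partition_gf.
have triv m i : (M <= i)%N -> (1 + c * x ^+ i.+1) ^+ m = 1.
  by move=> Mi; rewrite (exprM0 xM0) ?mulr0 ?addr0 ?expr1n // leqW.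
rewrite (@prod_dissect _ M 5
  (fun i => (1 + c * x ^+ i.+1) ^+ parity_mult5 p q i.+1)) //; last first.
  by move=> i /triv.
rewrite (@prod_dissect _ M 5
  (fun i => (1 + c * x ^+ i.+1) ^+ parity_mult p q i.+1)) //; last first.
  by move=> i /triv.
rewrite !big_ord_recr !big_ord0 /= !mul1r.
have E r : (r < 4)%N ->
    \prod_(i < M) (1 + c * x ^+ (5 * i + r).+1) ^+ parity_mult5 p q (5 * i + r).+1 =
    \prod_(i < M) (1 + c * x ^+ (5 * i + r).+1) ^+ parity_mult p q (5 * i + r).+1.
  move=> r4; apply: eq_bigr => i _; rewrite /parity_mult5.
  by case: ifP => // d5; exfalso; move: d5; lia.
rewrite (E 0%N) // (E 1%N) // (E 2%N) // (E 3%N) // -mulrA; congr (_ * _).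
rewrite -big_split; apply: eq_bigr => i _ /=.
rewrite /parity_mult5 (_ : (5 %| (5 * i + 4).+1)%N) ?expr0 ?mul1r; last by lia.
rewrite -exprM /parity_mult (_ : (5 * i + 4).+1 = (5 * i.+1)%N) ?oddM //; lia.
Qed.

(** With sg, ta and eta the quotients s/s5, t/t5 and e/e5, where t is s at -x,
    the hypotheses are [quintic_relation] at x and at -x.  Eliminating the common
    terms leaves a multiple of sg^2 + ta^2; after cancellation this is [rel], and
    the conclusion is a combination of [rel] and the relation at x. *)
Lemma quintic_algebra x (sg sg' ta ta' eta : R) :
    (forall v, (sg ^+ 2 + ta ^+ 2) * v = 0 -> v = 0) ->
    (forall v, eta * v = 0 -> v = 0) ->
    sg * sg' = 1 -> ta * ta' = 1 ->
    (eta ^+ 2 - x * sg ^+ 2) * (1 - sg ^+ 4 * eta ^+ 2) = 4%:R * x * sg ^+ 2 ->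
    (eta ^+ 2 + x * ta ^+ 2) * (1 - ta ^+ 4 * eta ^+ 2) = - 4%:R * x * ta ^+ 2 ->
  sg' ^+ 4 * ta' ^+ 2 - sg ^+ 2 * eta ^+ 4 -
    x * (ta ^+ 2 * sg' ^+ 2 - sg ^+ 4 * eta ^+ 2) = 4%:R * x.
Proof.
move=> creg ereg ss tt D1 D2.
have rel : 1 - eta ^+ 2 * sg ^+ 2 * ta ^+ 2 -
    x * sg ^+ 2 * ta ^+ 2 * (ta ^+ 2 - sg ^+ 2) = 0.
  apply: creg; do 2 apply: (ereg).
  transitivity (ta ^+ 2 * ((eta ^+ 2 - x * sg ^+ 2) * (1 - sg ^+ 4 * eta ^+ 2)) +
     sg ^+ 2 * ((eta ^+ 2 + x * ta ^+ 2) * (1 - ta ^+ 4 * eta ^+ 2))); first by ring.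
  by rewrite D1 D2; ring.
apply/eqP; rewrite -subr_eq0; apply/eqP.
set X := (X in X = 0).
have : sg ^+ 4 * ta ^+ 2 * X = 0.
  transitivity ((sg * sg') ^+ 4 * (ta * ta') ^+ 2 - sg ^+ 6 * ta ^+ 2 * eta ^+ 4 -
    x * (ta ^+ 4 * sg ^+ 2 * (sg * sg') ^+ 2 - sg ^+ 8 * ta ^+ 2 * eta ^+ 2) -
    sg ^+ 2 * ta ^+ 2 * (4%:R * x * sg ^+ 2)).
    by rewrite /X; ring.
  by rewrite ss tt -D1 -[RHS]rel; ring.
move=> /(congr1 ( *%R (sg' ^+ 4 * ta' ^+ 2))); rewrite mulr0 => <-.
transitivity ((sg * sg') ^+ 4 * (ta * ta') ^+ 2 * X); last by ring.
by rewrite ss tt; ring.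
Qed.

(** The sum of two elements with constant term 1 has constant term 2, so it can
    be cancelled as soon as 2 can. *)
Lemma two_one_mod_regular x u v w : x ^+ M = 0 ->
    (forall a : R, 2%:R * a = 0 -> a = 0) ->
    one_mod x u -> one_mod x v -> (u + v) * w = 0 -> w = 0.
Proof.
move=> xM0 reg2 [a ->] [b ->] e.
have step k : x ^+ k * w = 0 -> w = 0.
  elim: k => [|k IH]; first by rewrite expr0 mul1r.
  move=> xw; apply: IH; apply: reg2.
  transitivity (x ^+ k * ((1 + x * a + (1 + x * b)) * w) -
    (a + b) * (x ^+ k.+1 * w)).
    by rewrite exprS; ring.
  by rewrite e xw !mulr0 subr0.
by apply: (step M); rewrite xM0 mul0r.
Qed.

(** The generating function of the theorem: the coefficient of x^N on the left is
    2 (D_S(N) - D_T(N-1)), and the right-hand side has no term of degree N >= 2. *)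
Lemma generating_identity x : x ^+ M = 0 ->
    (forall a : R, 2%:R * a = 0 -> a = 0) ->
  odd_partition_gf multS x - x * odd_partition_gf multT x = 4%:R * x.
Proof.
move=> xM0 reg2.
have x5M0 : (x ^+ 5) ^+ M = 0 by apply: exprM0X.
have nxM0 := exprM0N xM0.
have x10 : (x ^+ 5) ^+ 2 = x ^+ 10 by rewrite -exprM.
have nx5 : (- x) ^+ 5 = - x ^+ 5 by rewrite exprNn; ring.
have nx10 : (- x) ^+ 10 = x ^+ 10 by rewrite exprNn; ring.
have gm y p q : y ^+ M = 0 ->
    partition_gf (parity_mult p q) y (-1) = odd_euler y ^+ p * euler (y ^+ 2) ^+ q.
  move=> yM0; rewrite partition_gf_parity //.
  by congr (_ ^+ _ * _ ^+ _); apply: eq_bigr => i _; rewrite mulN1r.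
have gp y p q : y ^+ M = 0 -> partition_gf (parity_mult p q) y 1 =
    odd_euler (- y) ^+ p * (\prod_(i < M) (1 + (y ^+ 2) ^+ i.+1)) ^+ q.
  move=> yM0; rewrite partition_gf_parity // odd_eulerN.
  by congr (_ ^+ _ * _ ^+ _); apply: eq_bigr => i _; rewrite mul1r.
rewrite /odd_partition_gf -[multS]/(parity_mult5 2 4) -[multT]/(parity_mult5 4 2).
have Sm := partition_gf_parity5 (-1) 2 4 xM0.
have Tm := partition_gf_parity5 (-1) 4 2 xM0.
have Sp := partition_gf_parity5 1 2 4 xM0.
have Tp := partition_gf_parity5 1 4 2 xM0.
rewrite !gm // !gp // ?x10 in Sm Tm Sp Tp.
have P1 := euler_identity (exprM0X (isT : 0 < 2)%N xM0).
have P5 := euler_identity (exprM0X (isT : 0 < 10)%N xM0).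
rewrite -{2}x10 -!odd_eulerMN in P1 P5.
have D1 := quintic_relation xM0; have D2 := quintic_relation nxM0.
rewrite /= sqrrN nx5 nx10 in D1 D2.
have us : one_mod x (odd_euler x).
  by have := @one_mod_odd_euler R M x 1 isT; rewrite expr1.
have us5 : one_mod x (odd_euler (x ^+ 5)) by apply: one_mod_odd_euler.
have neg u : one_mod (- x) u -> one_mod x u.
  by move=> [a ->]; exists (- a); rewrite mulrN mulNr.
have ut : one_mod x (odd_euler (- x)).
  by apply: neg; have := @one_mod_odd_euler R M (- x) 1 isT; rewrite expr1.
have ut5 : one_mod x (odd_euler (- x ^+ 5)).
  by apply: neg; rewrite -nx5; apply: one_mod_odd_euler.
have ue : one_mod x (euler (x ^+ 2)) by apply: one_mod_euler.
have ue5 : one_mod x (euler (x ^+ 10)) by apply: one_mod_euler.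
(* Only the relations between the series matter from here on: w and w5 are the
   products of 1 + x^n over even n at x and at x^5, and tp, sp, tm, sm are the
   generating functions for T and S at c = 1 and c = -1. *)
move: (partition_gf _ _ _) (partition_gf _ _ _) (partition_gf _ _ _)
  (partition_gf _ _ _) Sm Tm Sp Tp P1 P5 D1 D2.
move: (\prod_(i < M) _) (\prod_(i < M) _) (odd_euler x) (odd_euler (- x))
  (odd_euler (x ^+ 5)) (odd_euler (- x ^+ 5)) (euler (x ^+ 2)) (euler (x ^+ 10))
  us us5 ut ut5 ue ue5.
move=> w w5 s t s5 t5 e e5 us us5 ut ut5 ue ue5 tp sp tm sm Sm Tm Sp Tp P1 P5 D1 D2.
have [si usi ssi] := one_mod_inv xM0 us; have [s5i us5i ss5i] := one_mod_inv xM0 us5.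
have [ti uti tti] := one_mod_inv xM0 ut; have [t5i ut5i tt5i] := one_mod_inv xM0 ut5.
have [e5i ue5i ee5i] := one_mod_inv xM0 ue5.
pose sg := s * s5i; pose sg' := si * s5; pose ta := t * t5i; pose ta' := ti * t5.
pose eta := e * e5i.
have sgs : s = sg * s5 by rewrite /sg -mulrA (mulrC s5i) ss5i mulr1.
have tat : t = ta * t5 by rewrite /ta -mulrA (mulrC t5i) tt5i mulr1.
have etae : e = eta * e5 by rewrite /eta -mulrA (mulrC e5i) ee5i mulr1.
have ss : sg * sg' = 1.
  by transitivity ((s * si) * (s5 * s5i)); [rewrite /sg /sg'; ring|rewrite ssi ss5i mulr1].
have tt : ta * ta' = 1.
  by transitivity ((t * ti) * (t5 * t5i)); [rewrite /ta /ta'; ring|rewrite tti tt5i mulr1].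
have ueta : one_mod x eta by apply: one_modM.
have wE : w = sg' * ta' * w5.
  transitivity (w * (s * si) * (t * ti) * (w5 * (s5 * t5))).
    by rewrite P5 ssi tti !mulr1.
  transitivity (w * (s * t) * sg' * ta' * w5); first by rewrite /sg' /ta'; ring.
  by rewrite P1 mul1r.
have uw5 : one_mod x w5.
  suff -> : w5 = s5i * t5i by apply: one_modM.
  transitivity (w5 * (s5 * t5) * (s5i * t5i)); last by rewrite P5 mul1r.
  transitivity (w5 * (s5 * s5i) * (t5 * t5i)); last by ring.
  by rewrite ss5i tt5i !mulr1.
have unit u v v' : one_mod x u -> u * v = u * v' -> v = v'.
  exact: one_mod_cancel xM0.
have uX u k : one_mod x u -> one_mod x (u ^+ k).
  move=> uu; elim: k => [|k IH]; rewrite ?expr0 ?exprS; first exact: one_mod1.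
  exact: one_modM.
have tmE : tm = sg ^+ 4 * eta ^+ 2.
  apply: (unit (s5 ^+ 4 * e5 ^+ 2)); first by apply: one_modM; apply: uX.
  by rewrite mulrC Tm sgs etae; ring.
have smE : sm = sg ^+ 2 * eta ^+ 4.
  apply: (unit (s5 ^+ 2 * e5 ^+ 4)); first by apply: one_modM; apply: uX.
  by rewrite mulrC Sm sgs etae; ring.
have spE : sp = sg' ^+ 4 * ta' ^+ 2.
  apply: (unit (t5 ^+ 2 * w5 ^+ 4)); first by apply: one_modM; apply: uX.
  rewrite mulrC Sp tat wE.
  transitivity ((ta * ta') ^+ 2 * (t5 ^+ 2 * w5 ^+ 4 * (sg' ^+ 4 * ta' ^+ 2))); first by ring.
  by rewrite tt expr1n mul1r.
have tpE : tp = ta ^+ 2 * sg' ^+ 2.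
  apply: (unit (t5 ^+ 4 * w5 ^+ 2)); first by apply: one_modM; apply: uX.
  rewrite mulrC Tp tat wE.
  transitivity ((ta * ta') ^+ 2 * (t5 ^+ 4 * w5 ^+ 2 * (ta ^+ 2 * sg' ^+ 2))); first by ring.
  by rewrite tt expr1n mul1r.
rewrite tmE smE spE tpE; apply: quintic_algebra ss tt _ _.
- by move=> v; apply: (two_one_mod_regular xM0 reg2); apply: uX; apply: one_modM.
- by move=> v e0; apply: (unit eta) => //; rewrite e0 mulr0.
- apply: (unit (s5 ^+ 6 * e5 ^+ 4)); first by apply: one_modM; apply: uX.
  transitivity ((e ^+ 2 * s5 ^+ 2 - x * e5 ^+ 2 * s ^+ 2) *
    (s5 ^+ 4 * e5 ^+ 2 - s ^+ 4 * e ^+ 2)).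
    by rewrite sgs etae; ring.
  by rewrite D1 sgs; ring.
apply: (unit (t5 ^+ 6 * e5 ^+ 4)); first by apply: one_modM; apply: uX.
transitivity ((e ^+ 2 * t5 ^+ 2 - - x * e5 ^+ 2 * t ^+ 2) *
  (t5 ^+ 4 * e5 ^+ 2 - t ^+ 4 * e ^+ 2)).
  by rewrite tat etae; ring.
by rewrite D2 tat; ring.
Qed.

End Quintic.

End ThetaIdentities.

(** * From generating functions to partitions *)

Section Combinatorics.
Local Open Scope fset_scope.
Local Open Scope ring_scope.

Lemma prod_1D_fpowerset (K : choiceType) (R : comNzRingType) (A : {fset K})
    (g : K -> R) :
  \prod_(z <- A) (1 + g z) = \sum_(P <- fpowerset A) \prod_(z <- P) g z.
Proof.
have [n] := ubnP #|` A|; elim: n A => // n IH A An.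
have [->|[a aA]] := fset_0Vmem A.
  by rewrite fpowerset0 big_seq_fset1 !big_seq_fset0.
have aA' : a \notin A `\ a by rewrite !inE eqxx.
rewrite -(fsetD1K aA) big_fsetU1 // IH; last first.
  by move: An; rewrite (cardfsD1 a) aA add1n ltnS.
set B := A `\ a in aA' *.
rewrite /= mulrDl mul1r [RHS](big_fsetID _ (fun P : {fset K} => a \notin P)) /=.
congr (_ + _).
  apply: eq_fbigl => P; rewrite !inE !fpowersetE.
  apply/idP/andP => [PB|[PaB aP]].
    split; first by rewrite (fsubset_trans PB) ?fsubsetU1.
    by apply: contra aA'; apply: (fsubsetP PB).
  apply/fsubsetP => z zP; have := fsubsetP PaB z zP; rewrite !inE.
  by case/predU1P => // za; rewrite -za zP in aP.
have -> : [fset P in fpowerset (a |` B) | ~~ (a \notin P)] =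
          [fset a |` P | P in fpowerset B].
  apply/fsetP => P; rewrite !inE negbK fpowersetE; apply/andP/imfsetP => /=.
    move=> [PaB aP]; exists (P `\ a); last by rewrite fsetD1K.
    by rewrite fpowersetE fsubDset.
  by move=> [Q]; rewrite fpowersetE => QB ->; rewrite fsetUS // fset1U1.
rewrite [RHS]big_imfset /=; last first.
  have aB P : P \in fpowerset B -> a \notin P.
    by rewrite fpowersetE => PB; apply: contra aA'; apply: (fsubsetP PB).
  move=> P Q PB QB; have aP := aB P PB; have aQ := aB Q QB.
  move=> /(congr1 (fun S => S `\ a)).
  by rewrite !fsetU1K.
rewrite mulr_sumr big_seq [RHS]big_seq; apply: eq_bigr => P; rewrite fpowersetE => PB.
by rewrite big_fsetU1 //; apply: contra aA'; apply: (fsubsetP PB).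
Qed.

Definition weight (P : {fset colored}) : nat := \sum_(z <- P) value z.

Lemma prod_copies_upto mult M (R : comNzRingType) (x c : R) :
  \prod_(z <- copies_upto mult M) (1 + c * x ^+ value z) = partition_gf M mult x c.
Proof.
rewrite /partition_gf -(big_mkord xpredT (fun i => (1 + c * x ^+ i.+1) ^+ mult i.+1)).
set s := [seq (n, c0) | n <- iota 1 M, c0 <- iota 0 (mult n)].
have us : uniq s.
  apply: allpairs_uniq_dep => [|n _|]; rewrite ?iota_uniq //.
  by move=> [n c1] [m c2] _ _ [-> ->].
have -> : \prod_(z <- copies_upto mult M) (1 + c * x ^+ value z) =
          \prod_(z <- s) (1 + c * x ^+ value z).
  apply: perm_big; apply: uniq_perm => // z.
  by rewrite /copies_upto inE.
rewrite /s big_allpairs_dep -[1%N]addn0 iotaDl big_map /index_iota subn0.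
apply: eq_bigr => i _; rewrite add1n /value /= big_const_seq count_predT size_iota.
by rewrite -Monoid.iteropE.
Qed.

(** Subtracting the signed count from the plain one leaves twice the partitions
    with an odd number of parts; parts above N cannot contribute, so any cut-off
    M >= N gives the same coefficient. *)
Lemma odd_partition_numberE mult N M : (N <= M)%N ->
  (odd_partition_gf M mult 'X)`_N = (odd_partition_number mult N)%:Z * 2 :> int.
Proof.
move=> NM; rewrite /odd_partition_gf; set A := copies_upto mult M.
have G (c : {poly int}) : partition_gf M mult 'X c =
    \sum_(P <- fpowerset A) c ^+ #|` P| * 'X^(weight P).
  rewrite -prod_copies_upto prod_1D_fpowerset; apply: eq_bigr => P _.
  rewrite big_split /=; congr (_ * _).
    by rewrite big_const_seq count_predT -Monoid.iteropE.
  by rewrite /weight expr_sum.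
rewrite !G -sumrB coef_sum.
have -> : odd_partition_number mult N =
    #|` [fset P in fpowerset A | (weight P == N) && odd #|` P|] |.
  rewrite /odd_partition_number.
  move: (partitions mult N) (in_partitions mult N) => Q QE.
  congr #|` _|; apply/fsetP => P.
  rewrite !inE QE /is_partition -/(weight P) fpowersetE andbA; congr (_ && _).
  apply: andb_id2r => /eqP wP; apply/allP/fsubsetP => [XP z zP|PA z zP].
    rewrite in_copies_upto (XP z zP) (leq_trans _ NM) // -wP /weight.
    by rewrite (big_rem z) //= leq_addr.
  by have := PA z zP; rewrite in_copies_upto => /andP[].
under eq_bigr => P _.
  rewrite expr1n -mulrBl -signr_odd coefMXn.
  have -> : (if (N < weight P)%N then 0
             else (1 - (-1) ^+ odd #|` P| : {poly int})`_(N - weight P)) =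
            if (weight P == N) && odd #|` P| then 2 else 0 :> int.
    case: ltngtP => [wN|wN|->] /=; first 1 last.
    - case: (odd _); rewrite ?expr1 ?expr0 ?subrr ?coef0 //.
      by rewrite opprK -polyCD coefC subn_eq0 leqNgt wN.
    - case: (odd _); rewrite ?expr1 ?expr0 ?subrr ?coef0 //.
      by rewrite opprK -polyCD coefC subnn.
    by [].
  over.
rewrite -big_mkcond big_fset_condE big_const_seq count_predT iter_addr_0.
by rewrite -[LHS]mulr_natr mulrC (natz #|` _|).
Qed.

(** The ring identity is applied with x the class of 'X in Z['X]/('X^(N+1)), where
    an element is zero exactly when its coefficients up to degree N are. *)
Lemma coef_generating_identity N :
  (odd_partition_gf N.+1 multS 'X - 'X * odd_partition_gf N.+1 multT 'X -
    4%:R * 'X : {poly int})`_N = 0.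
Proof.
pose Q : {poly int} :=
  odd_partition_gf N.+1 multS 'X - 'X * odd_partition_gf N.+1 multT 'X - 4%:R * 'X.
rewrite -/Q.
pose h : {poly int} := 'X^(N.+1).
pose phi : {rmorphism {poly int} -> {poly %/ h}} := in_qpoly h.
have phiX : phi 'X ^+ N.+1 = 0.
  rewrite -rmorphXn; apply: val_inj; rewrite /= /h mk_monic_Xn.
  exact: rmodpp (monicXn _ _).
have reg2 (a : {poly %/ h}) : 2%:R * a = 0 -> a = 0.
  rewrite mulr_natl mulr2n => /(congr1 val) /= aa; apply: val_inj; apply/polyP => i.
  have := congr1 (fun p : {poly int} => p`_i) aa.
  by rewrite coefD !coef0 => /eqP; rewrite -mulr2n Num.Theory.mulrn_eq0 => /eqP.
have phi_gf m c :
    phi (partition_gf N.+1 m 'X c) = partition_gf N.+1 m (phi 'X) (phi c).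
  rewrite rmorph_prod; apply: eq_bigr => i _.
  by rewrite rmorphXn rmorphD rmorphM rmorphXn rmorph1.
have : phi Q = 0.
  have := generating_identity phiX reg2.
  rewrite /Q /odd_partition_gf !rmorphB !rmorphM !rmorphB !phi_gf.
  rewrite rmorphN1 rmorph1 rmorph_nat => <-.
  by rewrite subrr.
move=> /(congr1 val) /=.
rewrite /h mk_monic_Xn => Q0.
by rewrite (rdivp_eq (monicXn _ N.+1) Q) [rmodp _ _]Q0 addr0 coefMXn ltnSn.
Qed.

End Combinatorics.

Theorem theorem3p23 (N : nat) (hN : 2 <= N) : D_S N = D_T (N - 1).
Proof.
case: N hN => [|[|N]] // _; rewrite subn1 /=.
have := coef_generating_identity N.+2.
rewrite coefB (coefB (_ - _)) coefXM !odd_partition_numberE //=; last exact: leqW.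
rewrite mulr_natl coefMn coefX /= /D_S /D_T.
lia.
Qed.
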